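(* For every integer $n\ge 1$, $$\sum_{\pi\in\mathtt{NC}(n)}q^{\mathrm{wt}'(\pi)}=q^{\binom n2}C_n(q^{-1}).$$
   Context: $\mathtt{NC}(n)$ is the set of non-crossing partitions of $\{1,\ldots,n\}$, i.e. set partitions $\pi$ such that whenever $a<b<c<d$, $a,c$ lie in a block $B_1$ and $b,d$ lie in a block $B_2$, one has $B_1=B_2$. For a block $B$, $\mathrm{wt}'(B):=\sum_{j\in B}(j-\min B)$, and for $\pi$ with blocks $B_1,\ldots,B_m$, $\mathrm{wt}'(\pi):=\sum_{i=1}^m\mathrm{wt}'(B_i)$. The $q$-Catalan numbers $C_n=C_n(q)$, $n\ge 0$, are the polynomials in $q$ defined by the formal power series identity $$z=\sum_{n=1}^{\infty}C_{n-1}(q)\,z^{n}(1-z)(1-qz)\cdots(1-q^{n-1}z);$$ equivalently $C_0=1$ and $C_{n+1}=\sum_{k=0}^nC_kC_{n-k}q^{(k+1)(n-k)}$. *)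

(* Defs.v *)
From HB Require Import structures.
From mathcomp Require Import all_boot all_order all_algebra.

Set Implicit Arguments.
Unset Strict Implicit.
Unset Printing Implicit Defensive.

Import GRing.Theory.
Local Open Scope ring_scope.

(* The ground set {1, ..., n} is represented by 'I_n = {0, ..., n-1}: both the
   non-crossing condition and wt' are invariant under translation. *)
Definition noncrossing (n : nat) (P : {set {set 'I_n}}) : bool :=
  [forall a : 'I_n, forall b : 'I_n, forall c : 'I_n, forall d : 'I_n,
    [&& a < b, b < c & c < d]%N ==>
    [forall B1 in P, forall B2 in P,
      [&& a \in B1, c \in B1, b \in B2 & d \in B2] ==> (B1 == B2)]].

Definition NC (n : nat) : {set {set {set 'I_n}}} :=
  [set P | partition P [set: 'I_n] && noncrossing P].

(* The default value n is never attained on a nonempty B. *)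
Definition min_block (n : nat) (B : {set 'I_n}) : nat :=
  \big[minn/n]_(j in B) (j : nat).

Definition wt_block (n : nat) (B : {set 'I_n}) : nat :=
  (\sum_(j in B) (j - min_block B))%N.

Definition wt (n : nat) (P : {set {set 'I_n}}) : nat :=
  (\sum_(B in P) wt_block B)%N.

(* z ^ n (1 - z) (1 - q z) ... (1 - q ^ (n - 1) z) as a polynomial in z over
   Z[q]: the outer 'X is z, the inner one is q. *)
Definition qbase (n : nat) : {poly {poly int}} :=
  'X^n * \prod_(i < n) (1 - ('X^i)%:P * 'X).

(* The identity z = \sum_(n >= 1) C_(n-1) z ^ n (1 - z) ... (1 - q ^ (n-1) z)
   in Z[q][[z]]: for each N, the coefficient of z ^ N in the partial sum up
   to M is that of z as soon as M >= N. *)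
Definition is_qCatalan (C : nat -> {poly int}) : Prop :=
  forall N M : nat, (N <= M)%N ->
    (\sum_(1 <= n < M.+1) (C n.-1)%:P * qbase n)`_N
      = ('X : {poly {poly int}})`_N.

(* q is the indeterminate, in the fraction field of Z[q]; the Laurent
   polynomials Z[q, 1/q] form a subring of this field. *)
Definition qvar : {fraction {poly int}} := tofrac 'X.

Definition eval_at (p : {poly int}) (x : {fraction {poly int}}) :
    {fraction {poly int}} :=
  (map_poly intr p).[x].

(* The identity has exactly one solution. *)
Lemma qbase_lt (n N : nat) : (N < n)%N -> (qbase n)`_N = 0.
Proof. by move=> lt; rewrite coefXnM lt. Qed.

Lemma qbase_diag (n : nat) : (qbase n)`_n = 1.
Proof.
rewrite coefXnM ltnn subnn -horner_coef0 horner_prod big1 // => i _.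
by rewrite !hornerE subr0.
Qed.

Lemma qbase_sum (C : nat -> {poly int}) (N M : nat) : (N.+1 <= M)%N ->
  (\sum_(1 <= n < M.+1) (C n.-1)%:P * qbase n)`_N.+1
    = \sum_(k < N) C k * (qbase k.+1)`_N.+1 + C N.
Proof.
move=> leNM; rewrite coef_sum big_add1 /= (big_cat_nat _ leNM) //=.
rewrite [X in _ + X]big1_seq ?addr0; last first.
  move=> i /andP[_]; rewrite mem_index_iota => /andP[leNi _].
  by rewrite coefCM qbase_lt ?mulr0.
rewrite big_nat_recr //= coefCM qbase_diag mulr1 big_mkord.
by congr (_ + _); apply: eq_bigr => i _; rewrite coefCM.
Qed.

Lemma is_qCatalan_unique (C D : nat -> {poly int}) :
  is_qCatalan C -> is_qCatalan D -> C =1 D.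
Proof.
move=> hC hD n; elim/ltn_ind: n => n IH.
have := etrans (hC _ _ (leqnn n.+1)) (esym (hD _ _ (leqnn n.+1))).
rewrite (qbase_sum C (leqnn _)) (qbase_sum D (leqnn _)).
rewrite (eq_bigr (fun k : 'I_n => D k * (qbase k.+1)`_n.+1)); last first.
  by move=> k _; rewrite IH.
by move/addrI.
Qed.

Fixpoint qCatalan_seq (m : nat) : seq {poly int} :=
  if m is N.+1 then
    let s := qCatalan_seq N in
    rcons s (('X : {poly {poly int}})`_N.+1
             - \sum_(k < N) s`_k * (qbase k.+1)`_N.+1)
  else [::].

Lemma is_qCatalan_exists : exists C : nat -> {poly int}, is_qCatalan C.
Proof.
have sz m : size (qCatalan_seq m) = m by elim: m => //= m IH; rewrite size_rcons IH.
have st m k : (k < m)%N -> (qCatalan_seq m)`_k = (qCatalan_seq k.+1)`_k.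
  elim: m => // m IH; rewrite ltnS leq_eqVlt => /orP[/eqP-> //|lt].
  by rewrite -(IH lt) [in LHS]/= nth_rcons sz lt.
exists (fun k => (qCatalan_seq k.+1)`_k) => -[|N] M leNM.
  rewrite coef_sum big1_seq ?coefX // => i /andP[_].
  rewrite mem_index_iota => /andP[i0 _].
  by rewrite coefCM qbase_lt ?mulr0.
rewrite (qbase_sum (fun k => (qCatalan_seq k.+1)`_k) leNM).
rewrite [(qCatalan_seq N.+1)`_N]/= nth_rcons sz ltnn eqxx.
rewrite (eq_bigr (fun k : 'I_N => (qCatalan_seq N)`_k * (qbase k.+1)`_N.+1)).
  by rewrite addrC subrK.
by move=> k _; rewrite [in RHS]st.
Qed.

(* Main.v *)
Require Import Defs.
From HB Require Import structures.
From mathcomp Require Import all_boot all_order all_algebra.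
From mathcomp Require Import ring zify.

Import GRing.Theory.
Local Open Scope ring_scope.

(** Both sides satisfy the same quadratic recurrence.

    Right-hand side.  The series identity determines the C_n, so it is enough
    that the solution of
      C_0 = 1,  C_(n+1) = sum_k C_k C_(n-k) q^((k+1)(n-k))
    satisfies it.  With e_n(z) = z^n (1 - z) ... (1 - q^(n-1) z) there is a
    factorization e_(k+l)(z) = q^(-kl) e_k(z) e_l(q^k z).  Substituting the
    recurrence into f(z) = sum_n C_(n-1) e_n(z) therefore gives
      f(z) = z (1 - z) + sum_k C_k e_(k+1)(z) q^(-(k+1)) f(q^(k+1) z),
    and f(z) = z follows one power of z at a time: if f(w) = w up to some
    order, the sum is z f(z) = z^2 up to the next order.  To stay among
    polynomials, partial sums of q^(-s) f(q^s z) are used for all s at once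
    (qshift_sum, qshift_sum_modX, qCatalan_carlitz_recurrence).

    Left-hand side.  Record a partition of {0, ..., n-1} by the list s whose
    entry s_i is the minimum of the block of i.  The partition is non-crossing
    exactly when s_i <= i for all i, and s_j <= s_i whenever s_j <= i < j
    (minima_NC, minima_surj), and its weight is the sum of the i - s_i.  In
    such a list of length n+1 with last entry m, no entry at or after position
    m is below m; hence the list splits at m into a list of the same kind of
    length m, a translate by m of one of length n - m, and the final m
    (NC_minimaS).  The last entry weighs n - m, so the generating function W
    satisfies W_(n+1) = sum_m q^(n-m) W_m W_(n-m) (NC_gfS).

    Since binom(k+l+1, 2) = binom(k, 2) + binom(l, 2) + k + (k+1) l, the
    recurrence for C_n becomes that of W_n under
    C_n(q) |-> q^binom(n,2) C_n(1/q). *)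

(** * The recurrence for the q-Catalan numbers *)

Definition carlitz_recurrence (C : nat -> {poly int}) : Prop :=
  C 0%N = 1 /\ forall n : nat,
    C n.+1 = \sum_(k < n.+1) C k * C (n - k)%N * 'X^(k.+1 * (n - k)).

(** The recurrence refers to all earlier terms, so the whole list of the first
    m terms is built by structural recursion. *)
Fixpoint carlitz_prefix (m : nat) : seq {poly int} :=
  if m is N.+1 then
    let s := carlitz_prefix N in
    rcons s (if N is n.+1 then
               \sum_(k < n.+1) s`_k * s`_(n - k) * 'X^(k.+1 * (n - k))
             else 1)
  else [::].

Lemma carlitz_recurrence_exists : exists C, carlitz_recurrence C.
Proof.
have sz m : size (carlitz_prefix m) = m.
  by elim: m => //= m IH; rewrite size_rcons IH.
have st m k : (k < m)%N -> (carlitz_prefix m)`_k = (carlitz_prefix k.+1)`_k.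
  elim: m => // m IH; rewrite ltnS leq_eqVlt => /orP[/eqP-> //|lt].
  by rewrite -(IH lt) [in LHS]/= nth_rcons sz lt.
exists (fun k => (carlitz_prefix k.+1)`_k); split=> // n.
have -> : carlitz_prefix n.+2 = rcons (carlitz_prefix n.+1)
    (\sum_(k < n.+1) (carlitz_prefix n.+1)`_k * (carlitz_prefix n.+1)`_(n - k)
                      * 'X^(k.+1 * (n - k))) by [].
rewrite nth_rcons sz ltnn eqxx; apply: eq_bigr => k _.
by rewrite (st n.+1 k) // (st n.+1 (n - k)%N) // ltnS leq_subr.
Qed.

Lemma sum_triangle {V : nmodType} (G : nat -> nat -> V) (M : nat) :
  \sum_(m < M) \sum_(k < m.+1) G k (m - k)%N
    = \sum_(k < M) \sum_(l < M - k) G k l.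
Proof.
elim: M => [|M IH]; first by rewrite !big_ord0.
rewrite big_ord_recr IH /=.
transitivity (\sum_(k < M.+1) (\sum_(l < M - k) G k l + G k (M - k)%N)).
  by rewrite big_split /= [in RHS]big_ord_recr /= subnn big_ord0 addr0.
by apply: eq_bigr => k _; rewrite subSn ?big_ord_recr // -ltnS.
Qed.

(** The polynomial q^(-sn) e_n(q^s z), where e_n(z) is [qbase n]. *)
Definition qshift_base (s n : nat) : {poly {poly int}} :=
  'X^n * \prod_(i < n) (1 - ('X^(s + i))%:P * 'X).

(** The normalization by q^(-sn) is what makes this factorization free of
    powers of q: the second factor just starts where the first one stops. *)
Lemma qshift_baseD (s k l : nat) :
  qshift_base s (k + l) = qshift_base s k * qshift_base (s + k) l.
Proof.
rewrite /qshift_base exprD big_split_ord /= mulrACA.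
by congr (_ * (_ * _)); apply: eq_bigr => i _; rewrite addnA.
Qed.

(** A partial sum of q^(-s) f(q^s z), for f(z) = sum_n C_(n-1) e_n(z). *)
Definition qshift_sum (C : nat -> {poly int}) (s M : nat) : {poly {poly int}} :=
  \sum_(m < M) (C m * 'X^(s * m))%:P * qshift_base s m.+1.

(** Each C_m with m > 0 is expanded by the recurrence.  The twist
    q^((k+1)l) in it is what the shift of the second factor by k+1 requires,
    so that for fixed k the sum over l is again a partial sum of shifted
    series. *)
Lemma qshift_sumS (C : nat -> {poly int}) (s M : nat) :
  carlitz_recurrence C ->
  qshift_sum C s M.+1 = 'X * (1 - ('X^s)%:P * 'X)
    + ('X^s)%:P * \sum_(k < M) (C k * 'X^(s * k))%:P * qshift_base s k.+1
                                * qshift_sum C (s + k.+1) (M - k).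
Proof.
move=> [C0 CS]; rewrite {1}/qshift_sum big_ord_recl /=.
congr (_ + _).
  by rewrite C0 muln0 expr0 mulr1 mul1r /qshift_base big_ord1 expr1 addn0.
pose G k l := ('X^s)%:P * ((C k * 'X^(s * k))%:P * qshift_base s k.+1
   * ((C l * 'X^((s + k.+1) * l))%:P * qshift_base (s + k.+1) l.+1)).
transitivity (\sum_(m < M) \sum_(k < m.+1) G k (m - k)%N).
  apply: eq_bigr => m _; rewrite /bump /= add1n CS mulr_suml rmorph_sum mulr_suml.
  apply: eq_bigr => k _; rewrite /G.
  have le_km : (k <= m)%N by rewrite -ltnS.
  set l := (m - k)%N.
  have -> : m.+2 = (k.+1 + l.+1)%N by rewrite /l; lia.
  have -> : (s * m.+1 = s + (s * k + s * l))%N by rewrite /l; nia.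
  rewrite qshift_baseD mulnDl !exprD !polyCM; ring.
rewrite sum_triangle mulr_sumr; apply: eq_bigr => k _.
by rewrite /G -mulr_sumr -mulr_sumr.
Qed.

(** In the step from M to M + 1, the factor z^(k+1) in front of the sum of
    length M - k turns its error term into a multiple of z^(M+2); replacing
    each of these sums by z leaves z times the sum of length M, which is
    z^2 + O(z^(M+2)), and the terms q^s z^2 cancel.  The statement for all s
    is needed since the recursion changes s. *)
Lemma qshift_sum_modX (C : nat -> {poly int}) (s M : nat) :
  carlitz_recurrence C ->
  exists R, qshift_sum C s M = 'X + 'X^(M.+1) * R.
Proof.
move=> CC; elim/ltn_ind: M s => -[|M] IH s.
  by exists (-1); rewrite /qshift_sum big_ord0 expr1 mulrN1 subrr.
have [R1 e1] := IH M (ltnSn M) s.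
have [R2 e2] : exists R2, \sum_(k < M) (C k * 'X^(s * k))%:P * qshift_base s k.+1
    * qshift_sum C (s + k.+1) (M - k) = 'X * qshift_sum C s M + 'X^(M.+2) * R2.
  rewrite /qshift_sum mulr_sumr.
  elim/big_ind2: _ => [|x1 x2 y1 y2 [r ->] [t ->]|k _].
  - by exists 0; rewrite mulr0 addr0.
  - by exists (r + t); ring.
  have [R e] := IH (M - k)%N (leq_ltn_trans (leq_subr _ _) (ltnSn M)) (s + k.+1)%N.
  rewrite -/(qshift_sum C (s + k.+1) (M - k)) e /qshift_base.
  exists ((C k * 'X^(s * k))%:P * \prod_(i < k.+1) (1 - ('X^(s + i))%:P * 'X) * R).
  have -> : M.+2 = (k.+1 + (M - k).+1)%N by have := ltn_ord k; lia.
  rewrite exprD; ring.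
exists (('X^s)%:P * (R1 + R2)).
rewrite qshift_sumS // e2 e1 !exprS; ring.
Qed.

Lemma carlitz_recurrence_qCatalan {C : nat -> {poly int}} :
  carlitz_recurrence C -> is_qCatalan C.
Proof.
move=> CC N M leNM.
have -> : \sum_(1 <= n < M.+1) (C n.-1)%:P * qbase n = qshift_sum C 0 M.
  by rewrite big_add1 big_mkord; apply: eq_bigr => m _; rewrite mul0n mulr1.
have [R ->] := qshift_sum_modX C 0 M CC.
by rewrite coefD coefXnM ltnS leNM addr0.
Qed.

(** Transported from the one sequence given by the recurrence, since the series
    identity has a single solution. *)
Lemma qCatalan_carlitz_recurrence {C : nat -> {poly int}} :
  is_qCatalan C -> carlitz_recurrence C.
Proof.
move=> hC; have [D DD] := carlitz_recurrence_exists.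
have eCD := is_qCatalan_unique hC (carlitz_recurrence_qCatalan DD).
case: DD => D0 DS; split=> [|n]; rewrite !eCD // DS.
by apply: eq_bigr => k _; rewrite !eCD.
Qed.

(** * Non-crossing partitions as lists of block minima *)

Lemma min_block_unique {n : nat} {B : {set 'I_n}} {i : 'I_n} :
  i \in B -> (forall j, j \in B -> (i <= j)%N) -> min_block B = i.
Proof.
move=> iB iP; apply/eqP; rewrite eqn_leq /min_block -minEnat.
apply/andP; split; rewrite -leEnat.
  exact: (Order.TotalTheory.bigmin_le_cond n (fun j : 'I_n => (j : nat))).
by apply/Order.TotalTheory.bigmin_geP; rewrite leEnat ltnW.
Qed.

Lemma min_blockP {n : nat} {B : {set 'I_n}} {i : 'I_n} : i \in B ->
  exists m : 'I_n, [/\ m \in B, min_block B = m & forall j, j \in B -> (m <= j)%N].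
Proof.
move=> iB; exists [arg min_(m < i in B) m]%N.
by case: arg_minnP => // m mB mP; split=> //; apply: min_block_unique.
Qed.

(** The last clause, at i = s_j, also forces s_i = i: every entry is the minimum
    of its own block. *)
Definition nc_minima (n : nat) (s : seq nat) : Prop :=
  [/\ size s = n,
      forall i, (i < n)%N -> (nth 0 s i <= i)%N
    & forall i j, (i < j < n)%N -> (nth 0 s j <= i)%N -> (nth 0 s j <= nth 0 s i)%N].

Definition minima (n : nat) (P : {set {set 'I_n}}) : seq nat :=
  [seq min_block (pblock P i) | i <- enum 'I_n].

Lemma size_minima (n : nat) (P : {set {set 'I_n}}) : size (minima n P) = n.
Proof. by rewrite size_map size_enum_ord. Qed.

Lemma nth_minima (n : nat) (P : {set {set 'I_n}}) (i : 'I_n) :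
  nth 0%N (minima n P) i = min_block (pblock P i).
Proof. by rewrite (nth_map i) ?size_enum_ord // nth_ord_enum. Qed.

Lemma min_pblockP {n : nat} {P : {set {set 'I_n}}} (i : 'I_n) :
  partition P [set: 'I_n] ->
  exists m : 'I_n, [/\ m \in pblock P i, min_block (pblock P i) = m
                     & forall j, j \in pblock P i -> (m <= j)%N].
Proof.
move=> /cover_partition cP.
by apply: (min_blockP (i := i)); rewrite mem_pblock cP inE.
Qed.

(** Distinct blocks are disjoint, so they have distinct minima: the list of
    minima determines the partition. *)
Lemma mem_pblock_minima {n : nat} {P : {set {set 'I_n}}} (i j : 'I_n) :
  partition P [set: 'I_n] ->
  (j \in pblock P i) = (nth 0%N (minima n P) i == nth 0%N (minima n P) j).
Proof.
move=> partP; have [/eqP cP tP _] := and3P partP.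
rewrite -eq_pblock ?cP ?inE // !nth_minima.
apply/eqP/eqP => [-> // | e].
have [m [mi ei _]] := min_pblockP i partP.
have [m' [mj ej _]] := min_pblockP j partP.
have emm : m = m' by apply: val_inj; rewrite /= -ei e.
by rewrite -(same_pblock tP mi) emm (same_pblock tP mj).
Qed.

Lemma minima_inj (n : nat) : {in NC n &, injective (minima n)}.
Proof.
move=> P Q; rewrite !inE => /andP[partP _] /andP[partQ _] e.
rewrite -(equivalence_partition_pblock partP).
rewrite -(equivalence_partition_pblock partQ).
apply: eq_imset => i; apply/setP=> j; rewrite !inE /=.
by rewrite !mem_pblock_minima // e.
Qed.

(** Let m_i, m_j be the minima of the blocks of i < j, with m_j <= i.  If
    m_i < m_j, then m_i < m_j <= i < j, and these would be a crossing unless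
    the two blocks are equal, which contradicts m_i < m_j. *)
Lemma minima_NC (n : nat) (P : {set {set 'I_n}}) :
  P \in NC n -> nc_minima n (minima n P).
Proof.
rewrite inE => /andP[partP /forallP ncP]; split; first exact: size_minima.
  move=> i lt_i; rewrite (nth_minima n P (Ordinal lt_i)).
  have [m [_ -> mle]] := min_pblockP (Ordinal lt_i) partP.
  by apply: (mle (Ordinal lt_i)); rewrite mem_pblock (cover_partition partP) inE.
move=> i j /andP[lt_ij lt_j]; have lt_i := ltn_trans lt_ij lt_j.
have [/eqP cP tP _] := and3P partP.
pose oi := Ordinal lt_i; pose oj := Ordinal lt_j.
rewrite (nth_minima n P oi) (nth_minima n P oj).
have [mi [mi_i -> mi_le]] := min_pblockP oi partP.
have [mj [mj_j -> mj_le]] := min_pblockP oj partP.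
have oi_i : oi \in pblock P oi by rewrite mem_pblock cP inE.
have oj_j : oj \in pblock P oj by rewrite mem_pblock cP inE.
move=> le_mj_i; rewrite leqNgt; apply/negP => lt_m.
have eB : pblock P oi = pblock P oj.
  move: le_mj_i; rewrite leq_eqVlt => /orP[/eqP e|lt_mj_i].
    by rewrite -(same_pblock tP mj_j); congr pblock; apply: val_inj; rewrite /= e.
  have /forallP/(_ mj)/forallP/(_ oi)/forallP/(_ oj)/implyP := ncP mi.
  rewrite lt_m lt_mj_i lt_ij => /(_ isT)/forall_inP/(_ (pblock P oi)).
  rewrite pblock_mem ?cP ?inE // => /(_ isT)/forall_inP/(_ (pblock P oj)).
  rewrite pblock_mem ?cP ?inE // => /(_ isT)/implyP.
  by rewrite mi_i oi_i mj_j oj_j => /(_ isT)/eqP.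
by move: (mj_le mi); rewrite -eB => /(_ mi_i); rewrite leqNgt lt_m.
Qed.

(** The partition is that into the fibres of s.  For a < b < c < d with
    s_a = s_c and s_b = s_d, the last clause of [nc_minima] at (c, d) and at
    (b, c) gives s_d <= s_c <= s_b = s_d. *)
Lemma minima_surj (n : nat) (s : seq nat) :
  nc_minima n s -> exists2 P, P \in NC n & minima n P = s.
Proof.
case=> sz s_le s_nc.
pose P := preim_partition (fun i : 'I_n => nth 0%N s i) [set: 'I_n].
have partP : partition P [set: 'I_n] := preim_partitionP _ _.
have [_ tP _] := and3P partP.
have blockE (i j : 'I_n) : (j \in pblock P i) = (nth 0%N s i == nth 0%N s j).
  rewrite pblock_equivalence_partition ?inE //.
  by split=> // /eqP ->.
exists P.
  rewrite inE partP; apply/forallP=> a; apply/forallP=> b; apply/forallP=> c.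
  apply/forallP=> d; apply/implyP=> /and3P[ab bc cd].
  apply/forall_inP=> B1 B1P; apply/forall_inP=> B2 B2P.
  apply/implyP=> /and4P[aB1 cB1 bB2 dB2].
  have e1 : nth 0%N s a = nth 0%N s c.
    by apply/eqP; rewrite -blockE (def_pblock tP B1P aB1).
  have e2 : nth 0%N s b = nth 0%N s d.
    by apply/eqP; rewrite -blockE (def_pblock tP B2P bB2).
  rewrite -(def_pblock tP B1P aB1) -(def_pblock tP B2P bB2).
  rewrite eq_pblock ?(cover_partition partP) ?inE // blockE.
  have le_ba : (nth 0%N s d <= nth 0%N s c)%N.
    apply: s_nc; first by rewrite cd ltn_ord.
    by rewrite -e2 (leq_trans (s_le b _)) // ltnW.
  have le_ab : (nth 0%N s c <= nth 0%N s b)%N.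
    apply: s_nc; first by rewrite bc ltn_ord.
    by rewrite -e1 (leq_trans (s_le a _)) // ltnW.
  by rewrite e1 eqn_leq le_ab e2 le_ba.
apply: (@eq_from_nth _ 0%N); rewrite size_minima ?sz // => i lt_i.
rewrite (nth_minima n P (Ordinal lt_i)).
have le_i := s_le i lt_i; have lt_m := leq_ltn_trans le_i lt_i.
apply: (min_block_unique (i := Ordinal lt_m)).
  rewrite blockE /=; move: (le_i); rewrite leq_eqVlt => /orP[/eqP e|lt].
    by rewrite !e.
  by rewrite eqn_leq s_nc ?lt //= s_le.
move=> j; rewrite blockE => /eqP /= ->; exact: s_le.
Qed.

Definition NC_minima (n : nat) : seq (seq nat) :=
  [seq minima n P | P <- enum (NC n)].

Lemma NC_minima_uniq (n : nat) : uniq (NC_minima n).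
Proof.
rewrite map_inj_in_uniq ?enum_uniq // => P Q.
by rewrite !mem_enum; apply: minima_inj.
Qed.

Lemma NC_minimaP (n : nat) (s : seq nat) :
  reflect (nc_minima n s) (s \in NC_minima n).
Proof.
apply: (iffP mapP) => [[P + ->]|/minima_surj[P PNC <-]].
  by rewrite mem_enum; apply: minima_NC.
by exists P; rewrite ?mem_enum.
Qed.

(** The weight of a partition, read off its list of minima. *)
Definition depth (s : seq nat) : nat := \sum_(i < size s) (i - nth 0 s i)%N.

Lemma wt_minima (n : nat) (P : {set {set 'I_n}}) :
  P \in NC n -> wt P = depth (minima n P).
Proof.
rewrite inE => /andP[partP _]; have [_ tP _] := and3P partP.
rewrite /depth size_minima /wt.
transitivity (\sum_(i in [set: 'I_n]) (i - nth 0%N (minima n P) i))%N.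
  rewrite (set_partition_big _ partP) /=; apply: eq_bigr => B BP.
  apply: eq_bigr => j jB; by rewrite nth_minima (def_pblock tP BP jB).
by apply: eq_bigl => i; rewrite inE.
Qed.

(** * Decomposition at the minimum of the last block *)

Definition nc_glue (m : nat) (s t : seq nat) : seq nat :=
  rcons (s ++ map (addn m) t) m.

Lemma size_nc_glue (m : nat) (s t : seq nat) :
  size (nc_glue m s t) = (size s + size t).+1.
Proof. by rewrite size_rcons size_cat size_map. Qed.

Lemma nth_nc_glue (m : nat) (s t : seq nat) (i : nat) : size s = m ->
  nth 0%N (nc_glue m s t) i =
    if (i < m)%N then nth 0%N s i
    else if (i < m + size t)%N then (m + nth 0%N t (i - m))%N
    else if (i == m + size t)%N then m else 0%N.
Proof.
move=> sz; rewrite nth_rcons size_cat size_map nth_cat sz.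
case: (ltnP i m) => [lt|ge]; first by rewrite ltn_addr.
by case: ltnP => // lt; rewrite (nth_map 0%N) //; lia.
Qed.

(** The condition on i < j is vacuous for i < m <= j, since entries from
    position m on are at least m. *)
Lemma nc_minima_glue (m k : nat) (s t : seq nat) :
  nc_minima m s -> nc_minima k t -> nc_minima (m + k).+1 (nc_glue m s t).
Proof.
move=> [szs les ncs] [szt let_ nct]; split; first by rewrite size_nc_glue szs szt.
  move=> i lt_i; rewrite nth_nc_glue // szt.
  have := les i; have := let_ (i - m)%N; do 3?case: ifP; lia.
move=> i j lt_ij; rewrite !nth_nc_glue // szt.
have := ncs i j; have := nct (i - m)%N (j - m)%N.
by do 6?case: ifP; lia.
Qed.

(** The cut is at m = s_n.  An element i with m <= i < n lies below an arc of
    the block of n, so its block cannot reach below m: this is the last clause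
    of [nc_minima] at (i, n). *)
Lemma nc_minima_split (n : nat) (s : seq nat) : nc_minima n.+1 s ->
  exists m s1 s2, [/\ (m <= n)%N, nc_minima m s1, nc_minima (n - m) s2
                    & s = nc_glue m s1 s2].
Proof.
case=> sz s_le s_nc; pose m := nth 0%N s n.
have le_m : (m <= n)%N := s_le n (ltnSn n).
have ge_m i : (m <= i <= n)%N -> (m <= nth 0%N s i)%N.
  move=> /andP[m_i]; rewrite leq_eqVlt => /orP[/eqP -> //|i_n].
  by apply: s_nc; rewrite ?i_n /=.
pose s1 := take m s; pose s2 := [seq (x - m)%N | x <- take (n - m) (drop m s)].
have sz1 : size s1 = m by rewrite size_take sz ltnS le_m.
have sz2 : size s2 = (n - m)%N by rewrite size_map size_takel // size_drop sz; lia.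
have n1 i : (i < m)%N -> nth 0%N s1 i = nth 0%N s i by move=> lt; rewrite nth_take.
have n2 i : (i < n - m)%N -> nth 0%N s2 i = (nth 0%N s (m + i) - m)%N.
  move=> lt; rewrite (nth_map 0%N) ?nth_take ?nth_drop //.
  by rewrite size_takel // size_drop sz; lia.
exists m, s1, s2; split=> //.
- split=> // [i lt|i j lt]; first by rewrite n1 // s_le; lia.
  by rewrite !n1; try lia; apply: s_nc; lia.
- split=> // [i lt|i j lt]; rewrite !n2; try lia.
    by have := s_le (m + i)%N; lia.
  have := s_nc (m + i)%N (m + j)%N; have := ge_m (m + i)%N; lia.
apply: (@eq_from_nth _ 0%N) => [|i]; rewrite ?size_nc_glue sz ?sz1 ?sz2; first lia.
move=> lt; rewrite nth_nc_glue // sz2 subnKC //.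
case: ltnP => [lt_m|ge]; first by rewrite n1.
case: ltnP => [lt_n|ge_n].
  by rewrite n2 ?(subnKC ge) ?subnKC ?ge_m //; lia.
have -> : i = n by lia.
by rewrite eqxx.
Qed.

(** The last entry gives the position of the cut. *)
Lemma nc_glue_inj (m m' : nat) (s t s' t' : seq nat) :
  size s = m -> size s' = m' ->
  nc_glue m s t = nc_glue m' s' t' -> [/\ m = m', s = s' & t = t'].
Proof.
move=> sz sz' /rcons_inj[e em]; move: sz sz' e; rewrite -em => sz sz' /eqP.
rewrite eqseq_cat ?sz ?sz' // => /andP[/eqP-> /eqP e]; split=> //.
exact: inj_map (@addnI m) _ _ e.
Qed.

Lemma NC_minimaS (n : nat) :
  perm_eq (NC_minima n.+1)
    [seq nc_glue m st.1 st.2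
       | m <- iota 0 n.+1,
         st <- [seq (s, t) | s <- NC_minima m, t <- NC_minima (n - m)%N]].
Proof.
have szE m s : s \in NC_minima m -> size s = m by case/NC_minimaP.
apply: uniq_perm; first exact: NC_minima_uniq.
  apply: allpairs_uniq_dep => [|m _|]; first exact: iota_uniq.
    by rewrite allpairs_uniq ?NC_minima_uniq // => -[? ?] [? ?] _ _ [-> ->].
  move=> x y /allpairsPdep[m [_ [_ /allpairsP[[s t] [sE tE ->]] ->]]].
  move=> /allpairsPdep[m' [_ [_ /allpairsP[[s' t'] [sE' tE' ->]] ->]]].
  move: sE tE sE' tE' => /= sE tE sE' tE'.
  by case/(nc_glue_inj _ _ _ _ _ _ (szE _ _ sE) (szE _ _ sE')) => <- <- <-.
move=> u; apply/NC_minimaP/allpairsPdep.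
  move=> /nc_minima_split[m [s [t [le_m ncs nct ->]]]].
  exists m, (s, t); split=> //; first by rewrite mem_iota.
  by apply/allpairsP; exists (s, t); split=> //; apply/NC_minimaP.
move=> [m [_ [+ /allpairsP[[s t] /= [/NC_minimaP ncs /NC_minimaP nct ->]] ->]]] /=.
rewrite mem_iota add0n ltnS => /= le_m.
by have := nc_minima_glue _ _ _ _ ncs nct; rewrite subnKC.
Qed.

(** Translation preserves the contributions of t, and the new last entry sits
    at position m + size t with block minimum m. *)
Lemma depth_glue (m : nat) (s t : seq nat) : size s = m ->
  depth (nc_glue m s t) = (size t + (depth s + depth t))%N.
Proof.
move=> sz; rewrite /depth size_nc_glue big_ord_recr /= nth_nc_glue // sz.
rewrite ltnn eqxx big_split_ord /= addnC.
have -> : (m + size t < m)%N = false by lia.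
rewrite addKn; congr (_ + (_ + _))%N; apply: eq_bigr => i _; rewrite nth_nc_glue //=.
  by rewrite ltn_ord.
have -> : (m + i < m)%N = false by lia.
by rewrite ltn_add2l ltn_ord addKn subnDl.
Qed.

(** * The generating function of non-crossing partitions *)

Definition NC_gf {R : comNzRingType} (q : R) (n : nat) : R :=
  \sum_(P in NC n) q ^+ wt P.

Lemma NC_gf_minima {R : comNzRingType} (q : R) (n : nat) :
  NC_gf q n = \sum_(s <- NC_minima n) q ^+ depth s.
Proof.
rewrite big_map big_enum_cond /=.
by apply: eq_big => [P|P PNC]; rewrite ?andbT ?wt_minima.
Qed.

Lemma NC_gf0 {R : comNzRingType} (q : R) : NC_gf q 0 = 1.
Proof.
rewrite NC_gf_minima (perm_big [:: [::]]) /=.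
  by rewrite big_seq1 /depth big_ord0.
apply: uniq_perm => [||s]; rewrite ?NC_minima_uniq // inE.
apply/NC_minimaP/eqP => [[/size0nil]|->] //.
by split=> // i j; rewrite ltn0 andbF.
Qed.

Lemma NC_gfS {R : comNzRingType} (q : R) (n : nat) :
  NC_gf q n.+1 = \sum_(m < n.+1) q ^+ (n - m) * (NC_gf q m * NC_gf q (n - m)).
Proof.
rewrite NC_gf_minima (perm_big _ (NC_minimaS n)) big_allpairs_dep.
rewrite -(big_mkord xpredT (fun m => q ^+ (n - m) * (NC_gf q m * NC_gf q (n - m)))).
rewrite /index_iota subn0; apply: eq_bigr => m _.
rewrite big_allpairs_dep !NC_gf_minima /= big_distrlr /= mulr_sumr.
apply: eq_big_seq => s /NC_minimaP[szs _ _]; rewrite mulr_sumr.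
apply: eq_big_seq => t /NC_minimaP[szt _ _].
by rewrite depth_glue // szt !exprD.
Qed.

(** * Comparison of the two recurrences *)

Lemma bin2_addS (k l : nat) :
  'C((k + l).+1, 2) = ('C(k, 2) + 'C(l, 2) + k + k.+1 * l)%N.
Proof.
elim: l => [|l IH]; first by rewrite addn0 muln0 !addn0 binS bin1.
by rewrite addnS binS IH bin1 binS bin1; lia.
Qed.

(** The term-by-term comparison, with the values of the C_k as letters u and v:
    in an abstract field the normalization does not unfold fractions. *)
Lemma exprMV_rearrange {F : fieldType} (x u v : F) (a b k d : nat) : x != 0 ->
  x ^+ k * (x ^+ b * u * (x ^+ a * v))
    = x ^+ (a + b + k + d) * (v * u * x^-1 ^+ d).
Proof. by move=> x0; rewrite !exprD exprVn; field; rewrite expf_neq0. Qed.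

Lemma eval_atM (p r : {poly int}) (x : {fraction {poly int}}) :
  eval_at (p * r) x = eval_at p x * eval_at r x.
Proof. by rewrite /eval_at rmorphM hornerM. Qed.

(** The term k on the right corresponds to the cut m = n - k on the left, hence
    the reversal of the sum. *)
Lemma NC_gf_carlitz (C : nat -> {poly int}) (n : nat) :
  carlitz_recurrence C ->
  NC_gf qvar n = qvar ^+ 'C(n, 2) * eval_at (C n) qvar^-1.
Proof.
move=> [C0 CS].
have q0 : qvar != 0 by rewrite tofrac_eq0 polyX_eq0.
elim/ltn_ind: n => -[|n] IH.
  by rewrite NC_gf0 C0 /eval_at rmorph1 hornerC mulr1.
rewrite NC_gfS CS /eval_at rmorph_sum horner_sum mulr_sumr.
rewrite (reindex_inj rev_ord_inj); apply: eq_bigr => k _ /=.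
have le_k : (k <= n)%N by rewrite -ltnS.
rewrite -/(eval_at _ _) !eval_atM [eval_at 'X^_ _]/eval_at map_polyXn hornerXn.
rewrite subSS subKn // !IH ?ltnS ?leq_subr //.
have -> : 'C(n.+1, 2)
    = ('C(k, 2) + 'C(n - k, 2) + k + k.+1 * (n - k))%N.
  by rewrite -[in LHS](subnKC le_k) bin2_addS.
exact: exprMV_rearrange.
Qed.

Theorem proposition4p11 (C : nat -> {poly int}) (hC : is_qCatalan C)
    (n : nat) (hn : (1 <= n)%N) :
  \sum_(P in NC n) qvar ^+ wt P
    = qvar ^+ 'C(n, 2) * eval_at (C n) qvar^-1.
Proof.
exact: NC_gf_carlitz (qCatalan_carlitz_recurrence hC).
Qed.
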